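(* Let $\alpha\in[0,1)$ be an irrational number. Then the sturmian subshift $(\Omega_\alpha,T)$ is Cantor prime, i.e. it has no proper Cantor factor: every Cantor factor of $(\Omega_\alpha,T)$ is either isomorphic to $(\Omega_\alpha,T)$ or reduced to one point.
   Context: Sturmian subshift: for irrational $0<\alpha<1$ let $R_\alpha:[0,1)\to[0,1)$, $R_\alpha(t)=t+\alpha \pmod 1$, and $I_\alpha:[0,1)\to\{0,1\}$ with $I_\alpha(t)=0$ if $t\in[0,1-\alpha)$ and $I_\alpha(t)=1$ otherwise. Then $\Omega_\alpha\subset\{0,1\}^{\mathbb Z}$ is the closure of $\{(I_\alpha(R_\alpha^n(t)))_{n\in\mathbb Z}: t\in[0,1)\}$, and $T$ is the shift. A dynamical system $(X,S)$ is a compact metric space $X$ with a homeomorphism $S$. $(Y,S')$ is a factor of $(X,S)$ if there is a continuous onto map $\phi:X\to Y$ with $\phi S=S'\phi$; if $\phi$ is also one-to-one the systems are isomorphic. A factor $(Y,S')$ is proper if it is not isomorphic to $(X,S)$ and $Y$ is not a single point. A Cantor factor is a factor $(Y,S')$ where $Y$ is a Cantor space (has a countable basis of clopen sets and no isolated points) or $Y$ is finite (periodic factor). *)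

(* Defs.v *)
From HB Require Import structures.
From mathcomp Require Import all_boot all_order all_algebra.
From mathcomp Require Import all_classical all_reals all_analysis.

Set Implicit Arguments.
Unset Strict Implicit.
Unset Printing Implicit Defensive.

Import Order.TTheory GRing.Theory Num.Theory.

Local Open Scope classical_set_scope.
Local Open Scope ring_scope.

Definition homeomorphism (X : topologicalType) (S : X -> X) :=
  continuous S /\
  exists S' : X -> X, [/\ continuous S', cancel S S' & cancel S' S].

Definition dynamical_system (R : realType) (X : metricType R) (S : X -> X) :=
  compact [set: X] /\ homeomorphism S.

(* Factor maps and isomorphisms depend only on the topologies, so they are
   stated for topological spaces; the metric enters in [dynamical_system]. *)
Definition factor_map (X Y : topologicalType) (S : X -> X) (S' : Y -> Y)
    (phi : X -> Y) :=
  [/\ continuous phi, range phi = [set: Y] & phi \o S =1 S' \o phi].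

Definition is_factor (X Y : topologicalType) (S : X -> X) (S' : Y -> Y) :=
  exists phi : X -> Y, factor_map S S' phi.

Definition isomorphic (X Y : topologicalType) (S : X -> X) (S' : Y -> Y) :=
  exists2 phi : X -> Y, factor_map S S' phi & injective phi.

Definition single_point (Y : Type) := exists y : Y, [set: Y] = [set y].

Definition proper_factor (X Y : topologicalType) (S : X -> X) (S' : Y -> Y) :=
  [/\ is_factor S S', ~ isomorphic S S' & ~ single_point Y].

(* Used only for compact metric spaces, as in [cantor_factor]. *)
Definition cantor (Y : topologicalType) :=
  (exists B : set (set Y), [/\ countable B, basis B & B `<=` clopen]) /\
  isolated [set: Y] = set0.

Definition cantor_factor (R : realType) (X : topologicalType) (Y : metricType R)
    (S : X -> X) (S' : Y -> Y) :=
  [/\ dynamical_system S', is_factor S S' & cantor Y \/ finite_set [set: Y]].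

Definition cantor_prime (R : realType) (X : topologicalType) (S : X -> X) :=
  forall (Y : metricType R) (S' : Y -> Y),
    cantor_factor S S' -> isomorphic S S' \/ single_point Y.

Lemma cantor_primeE (R : realType) (X : topologicalType) (S : X -> X) :
  cantor_prime R S <->
  ~ exists (Y : metricType R) (S' : Y -> Y),
      cantor_factor S S' /\ proper_factor S S'.
Proof.
split=> [pS [Y [S' [cS' [_ niso nsp]]]]|npS Y S' cS'].
  by case: (pS _ _ cS').
apply: contrapT => /not_orP[niso nsp]; apply: npS; exists Y, S'.
by split=> //; split=> //; case: cS'.
Qed.

Definition rotation (R : realType) (a t : R) : R :=
  t + a - (Num.floor (t + a))%:~R.

(* On [0, 1[ the inverse of [rotation a] is [rotation (- a)], by [rotationK]. *)
Definition rotation_iter (R : realType) (a : R) (n : int) (t : R) : R :=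
  match n with
  | Posz k => iter k (rotation a) t
  | Negz k => iter k.+1 (rotation (- a)) t
  end.

(* The letters 0 and 1 are [false] and [true]. *)
Definition coding (R : realType) (a t : R) : bool := t \notin `[0, 1 - a[.

Definition coding_seq (R : realType) (a t : R) : {ptws int -> bool} :=
  fun n => coding a (rotation_iter a n t).

Definition sturmian (R : realType) (a : R) : set {ptws int -> bool} :=
  closure [set coding_seq a t | t in `[0, 1[].

Definition shift (x : {ptws int -> bool}) : {ptws int -> bool} :=
  fun n => x (n + 1).

Definition unshift (x : {ptws int -> bool}) : {ptws int -> bool} :=
  fun n => x (n - 1).

Lemma rotation_itv (R : realType) (a t : R) : rotation a t \in `[0, 1[.
Proof.
rewrite in_itv /= /rotation subr_ge0 ltrBlDl -intrD1.
exact: Num.Theory.floor_itv.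
Qed.

Lemma rotationK (R : realType) (a : R) :
  {in `[0, 1[, cancel (rotation a) (rotation (- a))}.
Proof.
move=> t; rewrite in_itv /= => /andP[t0 t1].
rewrite {1}/rotation {1 2}/rotation.
set m := Num.floor (t + a).
have -> : t + a - m%:~R - a = t + (- m)%:~R.
  by rewrite mulrNz addrAC addrK.
have -> : Num.floor (t + (- m)%:~R) = - m.
  apply: Num.Theory.floor_def.
  by rewrite intrD addrC lerDl t0 /= ltrD2l.
by rewrite addrK.
Qed.

Lemma rotationKV (R : realType) (a : R) :
  {in `[0, 1[, cancel (rotation (- a)) (rotation a)}.
Proof. by move=> t t01; rewrite -{1}[a]opprK rotationK. Qed.

Lemma rotation_iterS (R : realType) (a t : R) (n : int) : t \in `[0, 1[ ->
  rotation_iter a n (rotation a t) = rotation_iter a (n + 1) t.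
Proof.
move=> t01; case: n => [k|[|k]].
- by rewrite -PoszD addn1 /= -iterSr.
- by rewrite /= rotationK.
have -> : Negz k.+1 + 1 = Negz k by rewrite !NegzE -addn1 PoszD opprD addrNK.
by rewrite /rotation_iter iterSr rotationK.
Qed.

Lemma shift_coding_seq (R : realType) (a t : R) : t \in `[0, 1[ ->
  shift (coding_seq a t) = coding_seq a (rotation a t).
Proof.
by move=> t01; apply/funext => n; rewrite /shift /coding_seq rotation_iterS.
Qed.

Lemma shiftK : cancel shift unshift.
Proof. by move=> x; apply/funext => n; rewrite /shift /unshift subrK. Qed.

Lemma unshiftK : cancel unshift shift.
Proof. by move=> x; apply/funext => n; rewrite /shift /unshift addrK. Qed.

Lemma unshift_coding_seq (R : realType) (a t : R) : t \in `[0, 1[ ->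
  unshift (coding_seq a t) = coding_seq a (rotation (- a) t).
Proof.
move=> t01; apply: (can_inj shiftK).
by rewrite unshiftK shift_coding_seq ?rotation_itv// rotationKV.
Qed.

Lemma reindex_continuous (h : int -> int) :
  continuous (fun x : {ptws int -> bool} => (x \o h : {ptws int -> bool})).
Proof.
move=> x; apply/cvg_sup => n.
apply/cvg_image; first by rewrite eqEsubset; split=> v // _; exists (fun=> v).
move=> A /= xA.
exists ((fun z : {ptws int -> bool} => z n) @^-1` A); last first.
  rewrite image_preimage //.
  by rewrite eqEsubset; split=> v // _; exists (fun=> v).
have := @proj_continuous int (fun=> bool) (h n) x A xA.
exact.
Qed.

Lemma shift_continuous : continuous shift.
Proof. exact: (reindex_continuous (h := fun n => n + 1)). Qed.

Lemma unshift_continuous : continuous unshift.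
Proof. exact: (reindex_continuous (h := fun n => n - 1)). Qed.

Lemma closure_image_sub (X : topologicalType) (f : X -> X) (A : set X) :
  continuous f -> f @` A `<=` A -> f @` closure A `<=` closure A.
Proof.
move=> cf fA _ [x clAx <-] B /cf fB.
have [y [Ay By]] := clAx _ fB.
by exists (f y); split=> //; apply: fA; exists y.
Qed.

Lemma sturmian_shift (R : realType) (a : R) :
  shift @` sturmian a `<=` sturmian a.
Proof.
apply: closure_image_sub; first exact: shift_continuous.
move=> _ [_ [t t01 <-] <-]; exists (rotation a t); first exact: rotation_itv.
by rewrite shift_coding_seq.
Qed.

Lemma sturmian_unshift (R : realType) (a : R) :
  unshift @` sturmian a `<=` sturmian a.
Proof.
apply: closure_image_sub; first exact: unshift_continuous.
move=> _ [_ [t t01 <-] <-]; exists (rotation (- a) t); first exact: rotation_itv.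
by rewrite unshift_coding_seq.
Qed.

(* [sturmian a], used as a type, is the subset type with the induced topology. *)
Definition sturmian_map (R : realType) (a : R) (x : sturmian a) : sturmian a :=
  SigSub (mem_set (sturmian_shift (imageP shift (set_mem (valP x))))).

Definition sturmian_unmap (R : realType) (a : R) (x : sturmian a) : sturmian a :=
  SigSub (mem_set (sturmian_unshift (imageP unshift (set_mem (valP x))))).

Lemma sturmian_subtype_continuous (R : realType) (a : R)
    (f : sturmian a -> sturmian a) (g : {ptws int -> bool} -> {ptws int -> bool}) :
  continuous g -> (forall x, val (f x) = g (val x)) -> continuous f.
Proof.
move=> cg fg; apply/continuousP => _ [V oV <-].
rewrite -comp_preimage.
have -> : set_val \o f = g \o set_val by apply/funext => x; exact: fg.
rewrite comp_preimage; exists (g @^-1` V) => //.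
by move/continuousP: cg; exact.
Qed.

Lemma sturmian_map_homeomorphism (R : realType) (a : R) :
  homeomorphism (@sturmian_map R a).
Proof.
split; first exact: (sturmian_subtype_continuous shift_continuous).
exists (@sturmian_unmap R a); split.
- exact: (sturmian_subtype_continuous unshift_continuous).
- by move=> x; apply: val_inj; exact: shiftK.
- by move=> x; apply: val_inj; exact: unshiftK.
Qed.

Lemma sturmian_compact (R : realType) (a : R) : compact [set: sturmian a].
Proof.
have cX : compact [set: {ptws int -> bool}].
  have := @tychonoff int (fun=> bool) (fun=> setT) (fun=> bool_compact).
  by congr compact; rewrite eqEsubset.
have cA : compact (sturmian a).
  by apply: (subclosed_compact _ cX) => //; exact: closed_closure.
move=> F FF _.
have [|p [Ap clp]] := cA (set_val @ F) _.
  by apply: (@filterE _ F) => x; exact: set_mem (valP x).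
exists (SigSub (mem_set Ap)); split=> // U V FU; rewrite nbhsE.
case=> W [[W' oW' <-] W'p] WV.
have valU : (set_val @ F) (set_val @` U).
  by apply: (@filterS _ F _ U) => // u Uu; exists u.
have [_ [[u Uu <-] W'u]] := clp _ _ valU (open_nbhs_nbhs (conj oW' W'p)).
by exists u; split=> //; exact: WV.
Qed.

(* Main.v *)
(* Coding a rotation orbit by the differences of [floor (t + n a)], every point of
   the subshift is a limit of codings from the right or from the left at some
   [t], and the two limits differ only if [t] lies in the dense group [Z a + Z].
   A nontrivial factor [Y] has a clopen set separating two of its points; its
   preimage in the subshift is a clopen set [C], and [f b t], the truth value of
   membership in [C] of the [b]-sided coding at [t], is a 1-periodic function with
   one-sided limits and isolated jumps, all in [Z a + Z]. There is a jump, since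
   otherwise [f] would be constant.
   If the codings at [t] and [t'] have the same image in [Y], then [f] takes the
   same values along their orbits, so by density [t' - t] is a period of [f]. It
   translates jumps to jumps, so it lies in [Z a + Z]; were it not an integer, it
   would be irrational and the jumps would be dense. Finally, if
   [t' = t] is in [Z a + Z], its orbit meets a jump modulo 1, which tells the left
   coding from the right one. *)

Require Import Defs.
From mathcomp Require Import all_boot all_order all_algebra.
From mathcomp Require Import all_classical all_reals all_analysis.
From mathcomp Require Import ring lra.
Import Order.TTheory GRing.Theory Num.Theory.
Import numFieldNormedType.Exports.
Local Open Scope classical_set_scope.
Local Open Scope ring_scope.

(** * The dense group generated by [a] and 1 *)

Definition int_span {R : realType} (a : R) : set R :=
  [set x | exists n m : int, x = n%:~R * a + m%:~R].

Lemma int_spanD (R : realType) (a x y : R) :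
  int_span a x -> int_span a y -> int_span a (x + y).
Proof.
move=> [n [m ->]] [n' [m' ->]]; exists (n + n'), (m + m').
by rewrite !intrD mulrDl addrACA.
Qed.

Lemma int_spanZ (R : realType) (a x : R) (k : int) :
  int_span a x -> int_span a (k%:~R * x).
Proof.
move=> [n [m ->]]; exists (k * n), (k * m).
by rewrite !intrM mulrDr mulrA.
Qed.

Lemma int_spanB (R : realType) (a x y : R) :
  int_span a x -> int_span a y -> int_span a (x - y).
Proof.
move=> ax ay; apply: int_spanD => //.
by have := int_spanZ _ _ _ (-1) ay; rewrite mulrN1z mulN1r.
Qed.

Lemma int_span1 (R : realType) (a : R) : int_span a 1.
Proof. by exists 0, 1; rewrite mul0r add0r. Qed.

Lemma int_span_id (R : realType) (a : R) : int_span a a.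
Proof. by exists 1, 0; rewrite mul1r addr0. Qed.

Lemma irrational_intM (R : realType) (a x : R) (k n m : int) :
  irrational a -> k != 0 -> n%:~R * x + m%:~R = k%:~R * a -> irrational x.
Proof.
move=> aI k0 xa [q _ qx]; apply: aI; exists ((n%:~R * q + m%:~R) / k%:~R) => //.
rewrite fmorph_div rmorphD rmorphM /= !ratr_int qx xa mulrC mulKf//.
by rewrite intr_eq0.
Qed.

(* One step of Euclid's algorithm: one of [h] and [1] or [a] leaves a nonzero
   remainder, as otherwise [a] would be rational. *)
Lemma int_span_half (R : realType) (a h : R) : irrational a ->
  int_span a h -> 0 < h ->
  exists2 h', int_span a h' & 0 < h' <= h / 2.
Proof.
move=> aI ah h0.
have hN0 : h != 0 by rewrite gt_eqF.
have rem x : int_span a x -> x - (Num.floor (x / h))%:~R * h != 0 ->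
    exists2 h', int_span a h' & 0 < h' <= h / 2.
  move=> ax r0; set r := x - _ in r0.
  have ar : int_span a r by apply: int_spanB => //; exact: int_spanZ.
  have /andP[] := floor_itv (x / h); rewrite ler_pdivlMr// ltr_pdivrMr//.
  rewrite intrD mulrDl mul1r => r1 r2.
  have rp : 0 < r by rewrite lt_neqAle eq_sym r0 subr_ge0.
  have rh : r < h by rewrite ltrBlDl.
  (* A remainder above [h / 2] is replaced by [h - r]. *)
  have [rl|rg] := lerP r (h / 2).
    by exists r => //; rewrite rp.
  exists (h - r); first exact: int_spanB.
  by apply/andP; split; lra.
have [e1|] := eqVneq (1 - (Num.floor (1 / h))%:~R * h) 0; last first.
  exact/rem/int_span1.
have [ea|] := eqVneq (a - (Num.floor (a / h))%:~R * h) 0; last first.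
  exact/rem/int_span_id.
(* Now [a = p h] and [1 = q h], so [q a = p], and [irrational_intM] would make 1 irrational. *)
exfalso; move/subr0_eq : e1; move/subr0_eq : ea.
set p := Num.floor _; set q := Num.floor _ => ea e1.
have q0 : q != 0 by apply: contra_eq_neq e1 => ->; rewrite mul0r oner_neq0.
have : irrational (1 : R).
  apply: (@irrational_intM _ a _ q p 0) => //.
  by rewrite addr0 mulr1 ea mulrCA -e1 mulr1.
by apply; exists 1; rewrite // rmorph1.
Qed.

Lemma int_span_small (R : realType) (a e : R) : irrational a -> 0 < e ->
  exists2 h, int_span a h & 0 < h < e.
Proof.
move=> aI e0.
have pow k : exists2 h, int_span a h & 0 < h <= 2 ^- k.
  elim: k => [|k [h ah /andP[h0 hk]]].
    by exists 1; [exact: int_span1|rewrite expr0 invr1 ltr01 lexx].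
  have [h' ah' /andP[h'0 h'h]] := int_span_half _ _ _ aI ah h0.
  exists h' => //; rewrite h'0 (le_trans h'h)// exprSr invfM.
  by rewrite ler_pM2r// invr_gt0.
(* This exponent [k] exceeds [e^-1], and [2 ^ k > k]. *)
have [h ah /andP[h0 hk]] := pow (Num.bound e^-1).
exists h => //; rewrite h0 (le_lt_trans hk)// -[ltRHS]invrK.
rewrite ltf_pV2 ?posrE ?exprn_gt0 ?invr_gt0//.
apply: (lt_trans (archi_boundP _)); first by rewrite invr_ge0 ltW.
by rewrite -natrX ltr_nat ltn_expl.
Qed.

Lemma int_span_dense (R : realType) (a u v : R) : irrational a -> u < v ->
  exists2 h, int_span a h & u < h < v.
Proof.
move=> aI uv.
have vu : 0 < v - u by rewrite subr_gt0.
have [h ah /andP[h0 huv]] := int_span_small _ _ _ aI vu.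
(* The least multiple of [h] above [u] is at most [u + h], hence below [v]. *)
exists ((Num.floor (u / h) + 1)%:~R * h); first exact: int_spanZ.
have /andP[] := floor_itv (u / h); rewrite ler_pdivlMr// ltr_pdivrMr// => l r.
by rewrite r /= intrD mulrDl mul1r; lra.
Qed.

(** * One-sided codings of the rotation *)

Lemma near_ptws_cvg (I : Type) (F : set_system I) (u : I -> int -> bool)
    (x : {ptws int -> bool}) : Filter F ->
  (forall n, \forall i \near F, u i n = x n) ->
  (fun i => u i : {ptws int -> bool}) @ F --> x.
Proof.
move=> FF ux; apply/cvg_sup => n; apply/cvg_image.
  by rewrite eqEsubset; split=> v // _; exists (fun=> v).
move=> A /= /nbhs_singleton xA.
exists ((fun z : {ptws int -> bool} => z n) @^-1` A); last first.
  rewrite image_preimage //.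
  by rewrite eqEsubset; split=> v // _; exists (fun=> v).
by apply: filterS (ux n) => i /= ->.
Qed.

Lemma ptws_near_eval (x : {ptws int -> bool}) (n : int) :
  \forall y \near x, y n = x n.
Proof. exact: (@proj_continuous int (fun=> bool) n x _ (discrete_set1 _)). Qed.

(* [b = true] gives the limit of [Num.floor] from the left, [b = false] the one
   from the right. *)
Definition side_floor {R : realType} (b : bool) (x : R) : int :=
  if b then Num.ceil x - 1 else Num.floor x.

Lemma side_floor_eq (R : realType) (b : bool) (x : R) (m : int) :
  m%:~R < x < (m + 1)%:~R -> side_floor b x = m.
Proof.
move=> /andP[mx xm]; rewrite /side_floor; case: b.
  by rewrite (@ceil_def _ _ (m + 1)) ?addrK// mx ltW.
by apply: floor_def; rewrite ltW.
Qed.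

(** Close to [x] on the given side lie no integers, so there the two versions of the floor agree and
    [c] is arbitrary. *)
Lemma near_side_floor (R : realType) (b c : bool) (x : R) :
  \forall e \near 0^'+, side_floor c (x + (-1) ^+ b * e) = side_floor b x.
Proof.
case: b; rewrite /= ?expr1 ?expr0.
  have /andP[l r] := ceil_itv x.
  near=> e.
  have e0 : 0 < e by near: e; exact: nbhs_right_gt.
  have e1 : e < x - (Num.ceil x - 1)%:~R.
    by near: e; apply: nbhs_right_lt; rewrite subr_gt0.
  by apply: side_floor_eq; rewrite subrK; apply/andP; split; lra.
have /andP[l r] := floor_itv x.
near=> e.
have e0 : 0 < e by near: e; exact: nbhs_right_gt.
have e1 : e < (Num.floor x + 1)%:~R - x.
  by near: e; apply: nbhs_right_lt; rewrite subr_gt0.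
by apply: side_floor_eq; apply/andP; split; lra.
Unshelve. all: by end_near. Qed.

Lemma side_floorDz (R : realType) (b : bool) (x : R) (m : int) :
  side_floor b (x + m%:~R) = side_floor b x + m.
Proof.
rewrite /side_floor; case: b; last by rewrite floorDrz ?intr_int ?intrKfloor.
by rewrite ceilDrz ?intr_int// intrKceil addrAC.
Qed.

Lemma side_floor_nint (R : realType) (b c : bool) (x : R) :
  x \isn't a Num.int -> side_floor b x = side_floor c x.
Proof.
by move=> xI; rewrite /side_floor ceil_floor xI addrK; case: b; case: c.
Qed.

(** Letter [n] records whether the step from [t + n a] to [t + (n + 1) a] crosses an integer.
    Allowing every real [t] turns the rotation into a translation. *)
Definition side_code {R : realType} (a : R) (b : bool) (t : R) :
    {ptws int -> bool} :=
  fun n => side_floor b (t + n%:~R * a + a) != side_floor b (t + n%:~R * a).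

Lemma near_side_code (R : realType) (a : R) (b c : bool) (t : R) (n : int) :
  \forall e \near 0^'+,
    side_code a c (t + (-1) ^+ b * e) n = side_code a b t n.
Proof.
near=> e; rewrite /side_code.
have -> : t + (-1) ^+ b * e + n%:~R * a = t + n%:~R * a + (-1) ^+ b * e.
  by rewrite addrAC.
rewrite addrAC; congr (_ != _); near: e; exact: near_side_floor.
Unshelve. all: by end_near. Qed.

Lemma side_code_cvg (R : realType) (a : R) (b c : bool) (t : R) :
  side_code a c (t + (-1) ^+ b * e) @[e --> 0^'+] --> side_code a b t.
Proof. by apply: near_ptws_cvg => n; exact: near_side_code. Qed.

Lemma side_codeDz (R : realType) (a : R) (b : bool) (t : R) (m : int) :
  side_code a b (t + m%:~R) = side_code a b t.
Proof.
apply/funext => n; rewrite /side_code.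
have -> : t + m%:~R + n%:~R * a = t + n%:~R * a + m%:~R by rewrite addrAC.
by rewrite addrAC !side_floorDz (inj_eq (addIr _)).
Qed.

Lemma shift_side_code (R : realType) (a : R) (b : bool) (t : R) :
  Defs.shift (side_code a b t) = side_code a b (t + a).
Proof.
apply/funext => n; rewrite /Defs.shift /side_code intrD mulrDl mul1r.
by rewrite (addrC (_ * a)) addrA.
Qed.

(** Off the group [Z a + Z] the orbit of [t] avoids the integers, the only points where the two
    floors differ. *)
Lemma side_code_eq (R : realType) (a : R) (b c : bool) (t : R) :
  ~ int_span a t -> side_code a b t = side_code a c t.
Proof.
move=> tI.
have nint h : int_span a h -> t + h \isn't a Num.int.
  move=> ah; apply/negP => /intrP[m tm]; apply: tI.
  rewrite -(addrK h t) tm; apply: int_spanB => //.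
  by exists 0, m; rewrite mul0r add0r.
have ana n : int_span a (n%:~R * a) by apply/int_spanZ/int_span_id.
apply/funext => n; rewrite /side_code -!addrA.
congr (_ != _); apply: side_floor_nint; apply: nint => //.
by apply: int_spanD => //; exact: int_span_id.
Qed.

(** * The subshift as the set of one-sided codings *)

Lemma rotation_frac (R : realType) (a t : R) :
  rotation a (t - (Num.floor t)%:~R) = t + a - (Num.floor (t + a))%:~R.
Proof.
rewrite /rotation.
have -> : t - (Num.floor t)%:~R + a = t + a + (- Num.floor t)%:~R.
  by rewrite mulrNz addrAC.
by rewrite floorDrz ?intr_int// intrKfloor intrD; ring.
Qed.

Lemma iter_rotation_frac (R : realType) (a t : R) (k : nat) :
  iter k (rotation a) (t - (Num.floor t)%:~R) =
    t + k%:R * a - (Num.floor (t + k%:R * a))%:~R.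
Proof.
elim: k => [|k IHk]; first by rewrite mul0r addr0.
by rewrite iterS IHk rotation_frac -natr1 mulrDl mul1r [t + (_ + a)]addrA.
Qed.

Lemma rotation_iter_frac (R : realType) (a t : R) (n : int) :
  rotation_iter a n (t - (Num.floor t)%:~R) =
    t + n%:~R * a - (Num.floor (t + n%:~R * a))%:~R.
Proof.
case: n => k; first exact: iter_rotation_frac.
by rewrite /rotation_iter iter_rotation_frac NegzE mulrNz mulrN mulNr.
Qed.

Lemma coding_frac (R : realType) (a t : R) : 0 <= a < 1 ->
  coding a (t - (Num.floor t)%:~R) = (Num.floor (t + a) != Num.floor t).
Proof.
move=> /andP[a0 a1]; rewrite /coding in_itv /= floor_eq.
have /andP[l r] := floor_itv t; rewrite subr_ge0 l (le_trans l) ?lerDl//=.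
by rewrite intrD; congr (~~ _); apply/idP/idP => ?; lra.
Qed.

Lemma coding_seq_side_code (R : realType) (a t : R) : 0 <= a < 1 ->
  t \in `[0, 1[ -> coding_seq a t = side_code a false t.
Proof.
move=> a01; rewrite in_itv /= => t01; apply/funext => n.
have tE : t - (Num.floor t)%:~R = t by rewrite (floor_def (m := 0)) ?subr0.
by rewrite /coding_seq -[in LHS]tE rotation_iter_frac coding_frac.
Qed.

(** Right codings are codings of orbits in [[0, 1[], after reduction modulo 1, and left codings are
    limits of them. *)
Lemma sturmian_side_code (R : realType) (a : R) (b : bool) (t : R) :
  0 <= a < 1 -> sturmian a (side_code a b t).
Proof.
move=> a01.
have seqt s : [set coding_seq a t | t in `[0, 1[] (side_code a false s).
  have s01 : s - (Num.floor s)%:~R \in `[0, 1[.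
    (* Rotation by 0 is the fractional part. *)
    have := rotation_itv 0 s; by rewrite /rotation addr0.
  exists (s - (Num.floor s)%:~R) => //.
  by rewrite coding_seq_side_code// -mulrNz side_codeDz.
move=> V Vt.
have /filter_ex[e Ve] : \forall e \near 0^'+,
  V (side_code a false (t + (-1) ^+ b * e)) := side_code_cvg R a b false t V Vt.
by exists (side_code a false (t + (-1) ^+ b * e)).
Qed.

Lemma near_two_sided (R : realType) (P : R -> Prop) (t : R) : P t ->
  (forall b : bool, \forall e \near 0^'+, P (t + (-1) ^+ b * e)) ->
  \forall s \near t, P s.
Proof.
move=> Pt Pe.
have /(nbhs_right0P t) : \forall e \near 0^'+, P (t + e).
  by have := Pe false; apply: filterS => e; rewrite mul1r.
have /(nbhs_left0P t) : \forall e \near 0^'+, P (t - e).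
  by have := Pe true; apply: filterS => e; rewrite mulN1r.
rewrite !near_withinE => Pl Pr; near=> s.
have [st|st|->//] := ltgtP s t; first by apply: (near Pl s).
by apply: (near Pr s).
Unshelve. all: by end_near. Qed.

(** By compactness of [[0, 1]]: if [x] differs from both codings at every [t], some neighbourhood of
    [x] contains no [coding_seq a t], so [x] is not in their closure. *)
Lemma sturmianP (R : realType) (a : R) (x : {ptws int -> bool}) : 0 <= a < 1 ->
  sturmian a x -> exists b t, x = side_code a b t.
Proof.
move=> a01 ax; apply: contrapT => xN.
have neq b t : exists n, side_code a b t n <> x n.
  apply: contrapT => /forallNP xt; apply: xN; exists b, t; apply/funext => n.
  by apply: contrapT => /nesym; exact: xt.
have cov (t : R) : `[0, 1]%classic t ->
    \forall s \near t & y \near x, y <> side_code a false s.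
  (* Coordinate [nl] rules out the codings just left of [t], and [nr] those at [t] and just right of
     it. *)
  move=> _; have [nl xl] := neq true t; have [nr xr] := neq false t.
  pose Q s := side_code a false s nl <> x nl \/ side_code a false s nr <> x nr.
  have Qt : \forall s \near t, Q s.
    apply: near_two_sided; first by right.
    case; [apply: filterS (near_side_code R a true false t nl) => e el; left|].
      by rewrite el.
    apply: filterS (near_side_code R a false false t nr) => e er; right.
    by rewrite er.
  exists (Q, [set y : {ptws int -> bool} | y nl = x nl /\ y nr = x nr]).
    by split => //; apply: filterI; exact: ptws_near_eval.
  by move=> [s y] /= [Qs [yl yr]] ys; case: Qs; rewrite -ys.
have /compact_near_coveringP := @segment_compact R 0 1.
move=> /(_ _ _ (fun y s => y <> side_code a false s) _ cov) /ax.
move=> [_ [[t t01 <-]]] /(_ t); apply; last exact: coding_seq_side_code.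
by move: t01; rewrite /= !in_itv /= => /andP[-> /ltW ->].
Qed.

(** * Jumps and periods of functions with one-sided limits *)

Lemma near0_right_int_span (R : realType) (a x : R) (b : bool) (P : R -> Prop) :
  irrational a -> (\forall e \near 0^'+, P e) ->
  exists2 e, P e & int_span a (x + (-1) ^+ b * e).
Proof.
move=> aI; rewrite near_withinE => /nbhs_ballP[d /= d0 dP].
have Pd e : 0 < e < d -> P e.
  move=> /andP[e0 ed]; apply: dP => //.
  by rewrite /ball/= sub0r normrN gtr0_norm.
case: b.
  have [h ah /andP[hl hr]] : exists2 h, int_span a h & x - d < h < x.
    by apply: int_span_dense => //; lra.
  exists (x - h); first by apply: Pd; apply/andP; split; lra.
  by rewrite expr1 mulN1r opprB subrKC.
have [h ah /andP[hl hr]] : exists2 h, int_span a h & x < h < x + d.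
  by apply: int_span_dense => //; lra.
exists (h - x); first by apply: Pd; apply/andP; split; lra.
by rewrite expr0 mul1r subrKC.
Qed.

(** Values in [bool] make a limit an eventual equality. With [c] free, both [f false] and [f true]
    have the limit [f b t] on side [b], so jumps are isolated. *)
Definition sided_limits {R : realType} (f : bool -> R -> bool) :=
  forall (b c : bool) (t : R),
    \forall e \near 0^'+, f c (t + (-1) ^+ b * e) = f b t.

Lemma intM_periodic (R : realType) (T : Type) (g : R -> T) (d : R) (n : int) :
  (forall s, g (s + d) = g s) -> forall s, g (s + n%:~R * d) = g s.
Proof.
move=> gd; have gk k s : g (s + k%:R * d) = g s.
  elim: k s => [|k IHk] s; first by rewrite mul0r addr0.
  by rewrite -natr1 mulrDl mul1r addrA gd IHk.
case: n => k s; first exact: gk.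
by rewrite -(gk k.+1) NegzE mulrNz mulNr subrK.
Qed.

(* [{t + n a + m}] is dense, so every one-sided limit of [f] is reached along the
   orbit of [t], where [f] can be compared with its values along that of [t']. *)
Lemma orbit_translation (R : realType) (a : R) (f : bool -> R -> bool)
    (b c : bool) (t t' : R) : irrational a -> sided_limits f ->
  (forall d s, f d (s + 1) = f d s) ->
  (forall n : int, f b (t + n%:~R * a) = f c (t' + n%:~R * a)) ->
  forall d s, f d (s + (t' - t)) = f d s.
Proof.
move=> aI f_lim f1 ft d s.
have fm e u (m : int) : f e (u + m%:~R) = f e u.
  by rewrite -[m%:~R]mulr1 intM_periodic.
have [e [<- <-]] := near0_right_int_span _ _ (s - t) d _ aI
  (filterI (f_lim d b s) (f_lim d c (s + (t' - t)))).
move=> [n [m E]].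
have -> : s + (-1) ^+ d * e = t + n%:~R * a + m%:~R by rewrite -addrA -E; ring.
have -> : s + (t' - t) + (-1) ^+ d * e = t' + n%:~R * a + m%:~R.
  by rewrite -addrA -[RHS]addrA -E; ring.
by rewrite !fm ft.
Qed.

(* Jumps are isolated, and an irrational period would make them dense. *)
Lemma jump_irrational_period (R : realType) (f : bool -> R -> bool) (t d : R) :
  sided_limits f -> (forall b s, f b (s + 1) = f b s) ->
  (forall b s, f b (s + d) = f b s) -> f false t <> f true t -> ~ irrational d.
Proof.
move=> f_lim f1 fd tj dI; apply: tj.
(* The group is now [Z d + Z], whose elements are periods of [f]; [e] is one for which [t + e] is
   not a jump. *)
have [e [] /= e1 e2] := near0_right_int_span _ _ 0 false _ dI
  (filterI (f_lim false false t) (f_lim false true t)).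
rewrite add0r => -[n [m E]].
have per b : f b (t + (-1) ^+ false * e) = f b t.
  rewrite E addrA -[m%:~R]mulr1 intM_periodic; last exact: f1.
  by rewrite intM_periodic; last exact: fd.
by rewrite -[RHS]per -[LHS]per e1 e2.
Qed.

(** Without jumps [f false] and [f true] coincide and are locally constant, hence constant as the
    line is connected. *)
Lemma sided_limits_jump (R : realType) (f : bool -> R -> bool) (b c : bool)
    (u v : R) : sided_limits f -> f b u <> f c v ->
  exists t, f false t <> f true t.
Proof.
move=> f_lim uv; apply: contrapT => /forallNP /(_ _)/contrapT fE.
have side b' t : f b' t = f false t by case: b'; rewrite ?fE.
have f_near t : \forall s \near t, f false s = f false t.
  apply: near_two_sided => // b'; rewrite -(side b' t); exact: f_lim.
have clo (x : bool) : open [set s | f false s = x].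
  rewrite openE => t <-; exact: f_near.
apply: uv; rewrite !side.
have /connected_intervalP RC : is_interval [set: R] by [].
suff : [set s | f false s = f false v] = setT.
  by move=> vT; have : [set: R] u by []; rewrite -vT.
apply: RC.
- by exists v.
- by exists [set s | f false s = f false v]; rewrite ?setTI.
- exists [set s | f false s = f false v]; rewrite ?setTI//.
  rewrite -openC (_ : ~` _ = [set s | f false s = ~~ f false v])//.
  by apply/seteqP; split=> s /=; case: (f false s); case: (f false v).
Qed.

Lemma sided_orbit_inj (R : realType) (a : R) (f : bool -> R -> bool)
    (b c : bool) (t t' u : R) : irrational a -> sided_limits f ->
  (forall d s, f d (s + 1) = f d s) ->
  (forall s, f false s <> f true s -> int_span a s) ->
  f false u <> f true u ->
  (forall n : int, f b (t + n%:~R * a) = f c (t' + n%:~R * a)) ->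
  side_code a b t = side_code a c t'.
Proof.
move=> aI f_lim f1 f_jump uj ft.
have fd := orbit_translation _ _ _ _ _ _ _ aI f_lim f1 ft.
have [n [m E]] : int_span a (t' - t).
  (* Both [u] and [u + (t' - t)] are jumps. *)
  rewrite -(addrK u (t' - t)) [_ + u]addrC; apply: int_spanB; apply: f_jump => //.
  by rewrite !fd.
have [n0|n0] := eqVneq n 0; last first.
  exfalso; apply: (jump_irrational_period _ _ _ _ f_lim f1 fd uj).
  apply: (irrational_intM _ a _ n 1 (- m)) => //.
  by rewrite E mul1r mulrNz addrK.
have t'E : t' = t + m%:~R by rewrite -(subrKC t t') E n0 mul0r add0r.
rewrite t'E side_codeDz.
have [at_|] := pselect (int_span a t); last exact: side_code_eq.
have [k [l F]] := int_spanB _ _ _ _ (f_jump _ uj) at_.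
have fm e s (j : int) : f e (s + j%:~R) = f e s.
  by rewrite -[j%:~R]mulr1 intM_periodic.
(* The orbit of [t] meets [u] modulo 1, so the sides can be compared at the jump [u]; this forces
   [b = c]. *)
have : f b u = f c u.
  by rewrite -(subrKC t u) F addrA !fm ft t'E addrAC fm.
by move: uj; case: b {ft}; case: c => // uj /esym.
Qed.

(** * Factor maps of the subshift *)

(** Membership of the image of a one-sided coding in [U] is the function to which [sided_orbit_inj]
    applies; [x0] and [x1] provide its jump. *)
Lemma sturmian_factor_injective (R : realType) (a : R) (Y : Type) (S' : Y -> Y)
    (phi : sturmian a -> Y) (U : set Y) (x0 x1 : sturmian a) :
  0 <= a < 1 -> irrational a -> injective S' ->
  phi \o @sturmian_map R a =1 S' \o phi ->
  clopen (phi @^-1` U) -> U (phi x0) -> ~ U (phi x1) -> injective phi.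
Proof.
move=> a01 aI S'I phiS [oC cC] Ux0 Ux1.
pose pt b t : sturmian a := SigSub (mem_set (sturmian_side_code _ a b t a01)).
have ptP x : exists b t, x = pt b t.
  have [b [t xE]] := sturmianP _ _ _ a01 (set_mem (valP x)).
  by exists b, t; exact: val_inj.
have pt_map b t : sturmian_map (pt b t) = pt b (t + a).
  by apply: val_inj; exact: shift_side_code.
have pt_cvg (b c : bool) t : pt c (t + (-1) ^+ b * e) @[e --> 0^'+] --> pt b t.
  move=> B; rewrite nbhsE => -[_ [[V oV <-] Vt] VB].
  have nV : \forall e \near 0^'+, V (side_code a c (t + (-1) ^+ b * e)).
    by apply: (side_code_cvg R a b c t); exact: open_nbhs_nbhs.
  by apply: filterS nV => e Ve; exact: VB.
pose f b t := `[< U (phi (pt b t)) >].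
have f_lim : sided_limits f.
  (* Openness of the preimage settles the value [true], closedness the value [false]. *)
  move=> b c t; have [Ut|Ut] := pselect (U (phi (pt b t))).
    have nU : \forall e \near 0^'+, (phi @^-1` U) (pt c (t + (-1) ^+ b * e)).
      exact: (pt_cvg b c t _ (open_nbhs_nbhs (conj oC Ut))).
    by apply: filterS nU => e Ue; apply: asbool_equiv_eq.
  have nU : \forall e \near 0^'+, (~` (phi @^-1` U)) (pt c (t + (-1) ^+ b * e)).
    have oU : open (~` (phi @^-1` U)) by rewrite openC.
    exact: (pt_cvg b c t _ (open_nbhs_nbhs (conj oU Ut))).
  by apply: filterS nU => e Ue; apply: asbool_equiv_eq.
have f1 b t : f b (t + 1) = f b t.
  congr `[< U (phi _) >]; apply: val_inj; exact: (side_codeDz R a b t 1).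
have f_jump t : f false t <> f true t -> int_span a t.
  move=> ft; apply: contrapT => atN; apply: ft.
  by congr `[< U (phi _) >]; apply: val_inj; exact: side_code_eq.
have [u uj] : exists u, f false u <> f true u.
  have [b [t x0E]] := ptP x0; have [c [t' x1E]] := ptP x1.
  apply: (sided_limits_jump _ _ b c t t' f_lim); rewrite /f -x0E -x1E.
  by rewrite asboolT// asboolF.
move=> x y; have [b [t ->]] := ptP x; have [c [t' ->]] := ptP y => xy.
have fwd r r' : phi (pt b r) = phi (pt c r') ->
    phi (pt b (r + a)) = phi (pt c (r' + a)).
  by move=> E; rewrite -!pt_map [LHS]phiS [RHS]phiS /= E.
(* As [S'] is injective, equal images stay equal one step back. *)
have bwd r r' : phi (pt b r) = phi (pt c r') ->
    phi (pt b (r - a)) = phi (pt c (r' - a)).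
  move=> E; apply: S'I; have := phiS (pt b (r - a)); have := phiS (pt c (r' - a)).
  by rewrite /= !pt_map !subrK => <- <-.
have orbit (n : int) : phi (pt b (t + n%:~R * a)) = phi (pt c (t' + n%:~R * a)).
  elim/int_rect: n => [|n IHn|n IHn]; first by rewrite mul0r !addr0.
  - by rewrite -addn1 PoszD intrD mulrDl mul1r !addrA; exact: fwd.
  - by rewrite -addn1 PoszD opprD intrD mulrN1z mulrDl mulN1r !addrA; exact: bwd.
apply: val_inj; apply: (sided_orbit_inj R a f b c t t' u) => // n.
by rewrite /f orbit.
Qed.

(** In the Cantor case a basic clopen neighbourhood of [p] avoids [q]; in the finite case every
    subset is closed, so [[set p]] is clopen. *)
Lemma cantor_factor_separation (R : realType) (Y : metricType R) (p q : Y) :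
  cantor Y \/ finite_set [set: Y] -> p <> q ->
  exists U : set Y, [/\ clopen U, U p & ~ U q].
Proof.
have T1 : accessible_space Y.
  by apply: hausdorff_accessible; exact: metric_hausdorff.
have fin_closed := (accessible_finite_set_closed (T := Y)).1 T1.
move=> [[[B [_ [Bo Bb] Bclo]] _]|Yfin] pq.
  have /Bb[U [BU Up] Uq] : nbhs p (~` [set q]).
    apply: open_nbhs_nbhs; split => //.
    by rewrite openC; apply: fin_closed; exact: finite_set1.
  by exists U; split=> //; [exact: Bclo|move=> /Uq]; exact.
exists [set p]; split=> //; last exact: nesym.
split; last by apply: fin_closed; exact: finite_set1.
rewrite -[X in open X]setCK openC; apply: fin_closed.
exact: sub_finite_set Yfin.
Qed.

Theorem corollary12 (R : realType) (a : R) (ha0 : 0 <= a) (ha1 : a < 1)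
    (hirr : irrational a) :
  cantor_prime R (@sturmian_map R a).
Proof.
have a01 : 0 <= a < 1 by rewrite ha0.
move=> Y S' [[_ [_ [S'' [_ S'K _]]]] [phi fphi] cY].
have [[y0 [y1 y01]]|single] := pselect (exists y0 y1 : Y, y0 <> y1); last first.
  (* The subshift contains the coding at 0, so [Y] is nonempty. *)
  right; pose x := SigSub (mem_set (sturmian_side_code _ a false 0 a01)).
  exists (phi x); apply/seteqP; split=> // y _ /=.
  by apply: contrapT => yx; apply: single; exists y, (phi x).
left; exists phi => //; case: fphi => cphi phiT phiS.
have [U [cU Uy0 Uy1]] := cantor_factor_separation _ _ _ _ cY y01.
have [x0 _ x0E] : range phi y0 by rewrite phiT.
have [x1 _ x1E] : range phi y1 by rewrite phiT.
apply: (sturmian_factor_injective R a Y S' phi U x0 x1) => //.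
- exact: can_inj S'K.
- exact: preimage_clopen.
- by rewrite x0E.
- by rewrite x1E.
Qed.
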